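(* Let $X$ be a topologized poset. Then $X$ is complete if and only if each nonempty chain $C\subseteq X$ has a least upper bound $\sup C$ and a greatest lower bound $\inf C$ in $X$, and $\sup C\in\overline{C}$ and $\inf C\in\overline{C}$.
   Context: A topologized poset is a partially ordered set $(X,\le)$ endowed with a topology (no compatibility between order and topology is assumed). $\overline{A}$ denotes the closure of $A$ in $X$. A chain is a subset any two elements of which are comparable. A subset $D\subseteq X$ is up-directed (resp. down-directed) if for any $x,y\in D$ there is $z\in D$ with $x\le z$ and $y\le z$ (resp. $z\le x$ and $z\le y$). A topologized poset $X$ is up-complete if each nonempty up-directed set $D\subseteq X$ has a least upper bound $\sup D$ in $X$ and $\sup D\in\overline{D}$; it is down-complete if each nonempty down-directed set $D\subseteq X$ has a greatest lower bound $\inf D$ in $X$ and $\inf D\in\overline{D}$; it is complete if it is both up-complete and down-complete. *)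

(* Defs.v *)
From mathcomp Require Import all_boot all_order.
From mathcomp Require Import all_classical topology.

Set Implicit Arguments.
Unset Strict Implicit.
Unset Printing Implicit Defensive.

Local Open Scope classical_set_scope.
Local Open Scope order_scope.

(* A topologized poset is a [POrderedTopological.type d]: the join of the
   partial order and topological space structures, with no axiom relating
   the two.  It may be empty. *)

Definition chain d (X : porderType d) (C : set X) : Prop :=
  total_on C (fun x y => x <= y).

Definition up_directed d (X : porderType d) (D : set X) : Prop :=
  forall x y, D x -> D y -> exists2 z, D z & x <= z /\ y <= z.

Definition down_directed d (X : porderType d) (D : set X) : Prop :=
  forall x y, D x -> D y -> exists2 z, D z & z <= x /\ z <= y.

(* [supremums D] and [infimums D] are the sets of all least upper bounds and
   of all greatest lower bounds of D; each has at most one element. *)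

Definition up_complete d (X : POrderedTopological.type d) : Prop :=
  forall D : set X, D !=set0 -> up_directed D ->
    exists2 s, supremums D s & closure D s.

Definition down_complete d (X : POrderedTopological.type d) : Prop :=
  forall D : set X, D !=set0 -> down_directed D ->
    exists2 i, infimums D i & closure D i.

Definition complete d (X : POrderedTopological.type d) : Prop :=
  up_complete X /\ down_complete X.

(* Main.v *)
(**
Markowsky's theorem without ordinals.  Let F be a set closed under suprema of
nonempty chains (below, F is the closure of a directed set D).  Call a set A
good if, for every monotone map u from finite sets to F, the family of all
u S with S a finite subset of A has a supremum in F.  The empty set is good;
a union of a chain of good sets is good, as the corresponding suprema form a
chain; and if A is good, so is A with an element a added, since the finite
sets a |` S are cofinal.  By Zorn's lemma every set is good.  It remains to
choose a monotone map u from finite sets to D with u S an upper bound of S,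
by recursion on the cardinality: u S bounds S and all u R with R a proper
subset of S.
*)
Require Import Defs.
From mathcomp Require Import all_boot all_order.
From mathcomp Require Import finmap.
From mathcomp Require Import all_classical topology.

Import Order.TTheory.

Local Open Scope classical_set_scope.
Local Open Scope fset_scope.
Local Open Scope order_scope.

Definition chain_sup_closed {d} {X : porderType d} (F : set X) : Prop :=
  forall C : set X, C !=set0 -> (C `<=` F)%classic -> Defs.chain C ->
    exists2 s, supremums C s & F s.

Definition finite_images {T : choiceType} {X : Type} (u : {fset T} -> X)
    (A : set T) : set X :=
  [set x | exists2 S : {fset T}, {in S, forall t, A t} & u S = x].

(** By induction on [S]: one member of the chain contains all points but [t], another contains [t],
    and the larger of the two contains [S]. *)
Lemma finite_subset_bigcup_chain (T : choiceType) (G : set (set T))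
    (S : {fset T}) : G !=set0 -> total_on G subset ->
  {in S, forall t, (\bigcup_(A in G) A)%classic t} ->
  exists2 A, G A & {in S, forall t, A t}.
Proof.
move=> [A0 GA0] Gtot; elim/finSet_rect: S => S IHS SG.
have [->|[t tS]] := fset_0Vmem S; first by exists A0.
have [||A GA SA] := IHS (S `\ t); first exact: fproperD1.
  by move=> x; rewrite in_fsetD1 => /andP[_]; exact: SG.
have [B GB Bt] := SG t tS.
have SE x : x \in S -> x = t \/ x \in S `\ t.
  by move=> xS; rewrite in_fsetD1 xS andbT; case: eqVneq; [left|right].
case: (Gtot A B GA GB) => AB.
  by exists B => // x /SE[->//|/SA/AB].
by exists A => // x /SE[->|/SA//]; exact: AB.
Qed.

Section FiniteImages.
Context {d : Order.disp_t} {X : porderType d} {T : choiceType}.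
Variable F : set X.
Hypothesis F_closed : chain_sup_closed F.

(** Quantifying over [u] here, rather than fixing it, lets the step that adds a point [a] use the
    goodness of [A] at a different map, namely [u] precomposed with adjoining [a]. *)
Definition good (A : set T) : Prop :=
  forall u : {fset T} -> X, {homo u : R S / R `<=` S >-> R <= S} ->
    (forall S, F (u S)) ->
  exists2 s, supremums (finite_images u A) s & F s.

Lemma good0 : good set0.
Proof.
move=> u u_homo uF; exists (u fset0) => //; split.
  move=> x [S S0 <-]; apply: u_homo; apply/fsubsetP => t /S0 [].
by move=> x; apply; exists fset0.
Qed.

Lemma good_bigcup (G : set (set T)) :
  (G `<=` good)%classic -> total_on G subset -> good (\bigcup_(A in G) A)%classic.
Proof.
(* The empty chain is separate: it yields no suprema, and [F_closed] covers only nonempty chains. *)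
move=> Ggood Gtot; have [->|G0] := eqVneq G set0.
  by rewrite bigcup_set0; exact: good0.
move/set0P: G0 => G0 u u_homo uF.
pose C := [set s | exists2 A, G A & supremums (finite_images u A) s /\ F s].
have [|||s [s_ub s_lub] Fs] := F_closed C.
- have [A GA] := G0; have [s s_sup Fs] := Ggood A GA u u_homo uF.
  by exists s, A.
- by move=> s [A _ []].
- have mono A B s t : supremums (finite_images u A) s ->
      supremums (finite_images u B) t -> (A `<=` B)%classic -> s <= t.
    move=> [_ s_lub] [t_ub _] AB; apply: s_lub => x [S SA <-].
    by apply: t_ub; exists S => // y /SA/AB.
  move=> s t [A GA [sA _]] [B GB [tB _]].
  by case: (Gtot A B GA GB) => AB; [left|right]; apply: mono AB.
exists s => //; split.
- move=> x [S SG <-]; have [A GA SA] := finite_subset_bigcup_chain _ _ _ G0 Gtot SG.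
  have [t t_sup Ft] := Ggood A GA u u_homo uF.
  apply: (@le_trans _ _ t); first by apply: t_sup.1; exists S.
  by apply: s_ub; exists A.
- move=> y y_ub; apply: s_lub => t [A GA [[_ t_lub] _]]; apply: t_lub.
  by move=> x [S SA <-]; apply: y_ub; exists S => // z /SA Az; exists A.
Qed.

Lemma goodU1 (A : set T) (a : T) : good A -> good (a |` A)%classic.
Proof.
move=> A_good u u_homo uF.
have [||s [s_ub s_lub] Fs] := A_good (fun S => u (a |` S)).
- by move=> R S RS; apply: u_homo; exact: fsetUS.
- by move=> S; exact: uF.
exists s => //; split.
(* Removing [a] from [S] leaves a subset of [A]; putting it back gives a set containing [S], so [u]
   can only increase. *)
- move=> x [S SaA <-]; apply: (@le_trans _ _ (u (a |` (S `\ a)))).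
    apply: u_homo; apply/fsubsetP => t tS.
    by rewrite in_fset1U in_fsetD1 tS andbT orbN.
  apply: s_ub; exists (S `\ a) => // t; rewrite in_fsetD1 => /andP[ta /SaA[]//].
  by move=> ta'; rewrite ta' eqxx in ta.
- move=> y y_ub; apply: s_lub => x [S SA <-]; apply: y_ub; exists (a |` S) => //.
  by move=> t; rewrite in_fset1U => /orP[/eqP->|/SA]; [left|right].
Qed.

Lemma goodT : good setT.
Proof.
have [A [A_good A_max]] := Zorn_bigcup good_bigcup.
suff <- : A = setT by [].
apply/seteqP; split=> // a _; apply: contrapT => Aa.
apply: (A_max (a |` A)%classic); last exact: goodU1.
by split=> [x|/(_ a (or_introl erefl))//]; right.
Qed.

End FiniteImages.


(* The fuel n is only used with n >= #|` S|, where the value is independent of it. *)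
Fixpoint iterated_ub {T : choiceType} (ub : seq T -> T) (n : nat)
    (S : {fset T}) : T :=
  if n is m.+1 then
    ub (S ++ [seq iterated_ub ub m R | R <- fpowerset S & R `<` S])
  else ub S.

Lemma hereditary_finite_ub (T : choiceType) (r : T -> T -> Prop) :
  (forall s : seq T, exists y, {in s, forall x, r x y}) ->
  exists u : {fset T} -> T,
    {homo u : R S / R `<` S >-> r R S} /\
    (forall S, {in S, forall x, r x (u S)}).
Proof.
move=> /choice[ub ubP].
(* The value at [S] evaluates every proper subset [R] with one common fuel, while [u R] uses the
   cardinality of [R]; stability identifies the two. *)
have ub_stable n S : (#|` S| <= n)%N -> iterated_ub ub n S = iterated_ub ub #|` S| S.
  elim/ltn_ind: n S => -[|n] IHn S; first by rewrite leqn0 => /eqP->.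
  move=> Sn; case E: #|` S| => [|m] /=.
    move/cardfs0_eq: E => ->; rewrite (@eq_filter _ _ pred0) ?filter_pred0 //.
    by move=> R /=; rewrite fproperEcard cardfs0 ltn0 andbF.
  congr (ub (_ ++ _)); apply/eq_in_map => R.
  rewrite mem_filter => /andP[/fproper_ltn_card]; rewrite E ltnS => Rm _.
  rewrite E ltnS in Sn.
  by rewrite IHn ?(leq_trans Rm) // [RHS]IHn.
exists (fun S => iterated_ub ub #|` S| S); split=> [R S RS|S x xS].
  have := fproper_ltn_card RS; case E: #|` S| => [//|m] Rm /=.
  apply: ubP; rewrite mem_cat -(ub_stable m) //; apply/orP; right.
  by apply: map_f; rewrite mem_filter RS fpowersetE fproper_sub.
by case: #|` S| => [|m] /=; apply: ubP => //; rewrite mem_cat xS.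
Qed.

Section Directed.
Context {d : Order.disp_t} {X : porderType d}.

Lemma up_directed_seq_ub (D : set X) (s : seq D) :
  D !=set0 -> Defs.up_directed D ->
  exists y : D, {in s, forall x, val x <= val y}.
Proof.
move=> [x0 Dx0] D_dir; elim: s => [|x s [y ys]].
  by exists (exist _ x0 (mem_set Dx0)).
have [z Dz [xz yz]] := D_dir _ _ (set_valP x) (set_valP y).
exists (exist _ z (mem_set Dz)) => t; rewrite inE => /orP[/eqP->//|/ys ty].
exact: le_trans yz.
Qed.

Lemma up_directed_sup (F D : set X) : chain_sup_closed F -> (D `<=` F)%classic ->
  D !=set0 -> Defs.up_directed D -> exists2 s, supremums D s & F s.
Proof.
move=> F_closed DF D0 D_dir.
have [u [u_homo u_ub]] := @hereditary_finite_ub D (fun x y => val x <= val y)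
  (fun s => up_directed_seq_ub _ s D0 D_dir).
have [||s [s_ub s_lub] Fs] := goodT F F_closed (fun S => val (u S)).
- move=> R S; rewrite fsubEproper => /orP[/eqP->//|]; exact: u_homo.
- by move=> S; apply: DF; exact: set_valP.
(* The values of [u] lie in [D], and those at singletons dominate every element of [D]; hence both
   families have the same upper bounds. *)
exists s => //; split.
- move=> x Dx; pose x' : D := exist _ x (mem_set Dx).
  apply: (@le_trans _ _ (val (u [fset x']))).
    by apply: (u_ub _ x'); rewrite in_fset1.
  by apply: s_ub; exists [fset x'].
- by move=> y y_ub; apply: s_lub => _ [S _ <-]; apply: y_ub; exact: set_valP.
Qed.

End Directed.

Lemma down_directed_inf {d} {X : porderType d} (F D : set X) :
  (forall C : set X, C !=set0 -> (C `<=` F)%classic -> Defs.chain C ->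
    exists2 i, infimums C i & F i) ->
  (D `<=` F)%classic -> D !=set0 -> Defs.down_directed D ->
  exists2 i, infimums D i & F i.
Proof.
(* Duality: infima in [X] are suprema in [X^d], and chains are the same in both orders. *)
move=> F_closed; apply: (@up_directed_sup _ X^d) => C C0 CF C_chain.
by apply: F_closed => // x y Cx Cy; exact: C_chain.
Qed.

Theorem theorem2p10 (d : Order.disp_t) (X : POrderedTopological.type d) :
  Defs.complete X <->
  (forall C : set X, C !=set0 -> Defs.chain C ->
     (exists2 s : X, supremums C s & closure C s) /\
     (exists2 i : X, infimums C i & closure C i)).
Proof.
split=> [[X_up X_down] C C0 C_chain|X_chain].
  split; [apply: X_up => // x y Cx Cy|apply: X_down => // x y Cx Cy].
    by case: (C_chain x y Cx Cy) => ?; [exists y|exists x].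
  by case: (C_chain x y Cx Cy) => ?; [exists x|exists y].
(* Closure is idempotent, so the supremum of a chain in [closure D], lying in the closure of that
   chain, stays in [closure D]. *)
have closure_sub (C D : set X) :
    (C `<=` closure D)%classic -> (closure C `<=` closure D)%classic.
  by move/closureS; rewrite -(closure_id (closure D)).1 //; exact: closed_closure.
split=> D D0 D_dir.
- apply: (up_directed_sup _ _ _ (@subset_closure _ D)) => // C C0 CD C_chain.
  have [[s s_sup Cs] _] := X_chain C C0 C_chain.
  by exists s => //; exact: closure_sub Cs.
- apply: (down_directed_inf _ _ _ (@subset_closure _ D)) => // C C0 CD C_chain.
  have [_ [i i_inf Ci]] := X_chain C C0 C_chain.
  by exists i => //; exact: closure_sub Ci.
Qed.
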